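(* Let $G$ be a compact group such that $\widehat G$ is countable, $(\Pi,\mathcal{H})$ a finite-dimensional unitary representation of $G$, $\rho$ a faithful positive linear functional on $B(\mathcal{H})$, and $m\ge1$ an integer. Then $\Pi_{m,\infty}(B_{m,\rho})$ is contained in $K_{m,\rho}$. Moreover, $\Pi_{m,\infty}$ is injective on $\mathbb{M}_m(\mathbb{C})\otimes\mathcal{U}(G)$ if $(\Pi,\mathcal{H})$ is generating $\widehat G$.
   Context: $\widehat G$ is the set of equivalence classes of irreducible representations of $G$, with representatives $(\pi_\alpha,\mathcal{H}_\alpha)$. $\mathbb{C}[G]\subset C(G)$ is the algebra spanned by the matrix coefficients $c^\pi_{\xi,\eta}(t)=\langle\pi(t)\xi,\eta\rangle$ of finite-dimensional unitary representations, and $\mathcal{U}(G)=\mathbb{C}[G]^*$ is its algebraic dual, with pairing $(\cdot,\cdot)$. Each finite-dimensional unitary representation $(\pi,\mathcal{K})$ extends to $\pi:\mathcal{U}(G)\to B(\mathcal{K})$ by $\langle\pi(x)\xi,\eta\rangle=(x,c^\pi_{\xi,\eta})$, and $\mathcal{U}(G)\cong\prod_{\alpha\in\widehat G}B(\mathcal{H}_\alpha)$ via $x\mapsto(\pi_\alpha(x))_\alpha$. An element $x\in\mathbb{M}_m(\mathbb{C})\otimes\mathcal{U}(G)$ is positive if $(\mathrm{id}_m\otimes\pi)(x)$ is positive for every finite-dimensional unitary $\pi$; $(\cdot)_+$ denotes positive elements and $x\le y$ means $y-x$ is positive. The functional $\rho\circ\Pi$ on $\mathcal{U}(G)$ is again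 denoted $\rho$; it has the form $x\mapsto(x,f_\rho)$ with $f_\rho\in\mathbb{C}[G]$. Define $P_\rho:\mathcal{U}(G)\to\mathcal{U}(G)$ by $(P_\rho(x),f)=(x,ff_\rho)$, $P_{m,\rho}=\mathrm{id}_m\otimes P_\rho$, and $$B_{m,\rho}=\{x\in(\mathbb{M}_m(\mathbb{C})\otimes\mathcal{U}(G))_+\mid P_{m,\rho}(x)\le x\}.$$ $S_l$ acts on $B(\mathcal{H})^{\otimes l}$ by $\sigma\cdot(x_1\otimes\cdots\otimes x_l)=x_{\sigma(1)}\otimes\cdots\otimes x_{\sigma(l)}$; $(B(\mathcal{H})^{\otimes l})^{S_l}$ is the fixed-point algebra, $B(\mathcal{H})^{\otimes0}=\mathbb{C}$ and $S_0$ is trivial. Then $$K_{m,\rho}=\Big\{(x_l)_{l=0}^\infty\in\prod_{l=0}^\infty(\mathbb{M}_m(\mathbb{C})\otimes(B(\mathcal{H})^{\otimes l})^{S_l})_+\,\Big|\,(\mathrm{id}_m\otimes\mathrm{id}_{B(\mathcal{H})}^{\otimes l}\otimes\rho)(x_{l+1})\le x_l\ \text{for all } l\ge0\Big\}.$$ A positive functional is faithful if it is strictly positive on nonzero positive elements. For $l\ge1$, $\Pi^{\otimes l}:\mathcal{U}(G)\to B(\mathcal{H})^{\otimes l}$ is the extension to $\mathcal{U}(G)$ of the $l$-fold tensor product representation, and $\Pi^{\otimes0}(x)=(x,1)$ (the trivial representation). $\Pi_{m,l}=\mathrm{id}_m\otimes\Pi^{\otimes l}:\mathbb{M}_m(\mathbb{C})\otimes\mathcal{U}(G)\to\mathbb{M}_m(\mathbb{C})\otimes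 B(\mathcal{H})^{\otimes l}$, and $\Pi_{m,\infty}(x)=(\Pi_{m,l}(x))_{l=0}^\infty\in\prod_{l\ge0}\mathbb{M}_m(\mathbb{C})\otimes B(\mathcal{H})^{\otimes l}$. $(\Pi,\mathcal{H})$ is generating $\widehat G$ if for every $\alpha\in\widehat G$ there is $l\ge0$ such that $(\pi_\alpha,\mathcal{H}_\alpha)$ is a sub-representation of $(\Pi^{\otimes l},\mathcal{H}^{\otimes l})$. *)

(* Defs.v *)
From HB Require Import structures.
From mathcomp Require Import all_boot all_order all_algebra perm.
From mathcomp Require Import complex mxtens.
From mathcomp Require Import all_classical all_reals all_analysis.

Set Implicit Arguments.
Unset Strict Implicit.
Unset Printing Implicit Defensive.

Import Order.TTheory GRing.Theory Num.Theory.
Import numFieldNormedType.Exports.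

Local Open Scope classical_set_scope.
Local Open Scope sesquilinear_scope.
Local Open Scope ring_scope.

HB.mixin Record isTopologicalGroup G of Topological G & monoid.Group G := {
  mulg_continuous : continuous (fun p : G * G => (p.1 * p.2)%g);
  invg_continuous : continuous (fun g : G => (g^-1)%g)
}.

#[short(type="topologicalGroupType")]
HB.structure Definition TopologicalGroup :=
  {G of Topological G & monoid.Group G & isTopologicalGroup G}.

(* The complex numbers, packed so that the topology that MathComp-Analysis
   puts on an arbitrary [numClosedFieldType] is found by unification. *)
Definition Cplx (R : realType) : numClosedFieldType := R[i].

Section Operators.
Variable C : numClosedFieldType.

(* Hilbert spaces are the C^n of column vectors; linear on the left. *)
Definition inner n (u v : 'cV[C]_n) : C := (v^t* *m u) 0 0.

(* [0 <= z] in C means that z is real and nonnegative. *)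
Definition psdmx n (A : 'M[C]_n) : Prop :=
  forall v : 'cV[C]_n, 0 <= inner (A *m v) v.

(* M_m(C) (x) B(C^n) is the algebra of m x m matrices over B(C^n), acting on
   the direct sum of m copies of C^n. *)
Definition psdblock m n (X : 'M['M[C]_n]_m) : Prop :=
  psdmx (\mxblock_(i < m, j < m) X i j).

Definition positive_functional n (rho : {scalar 'M[C]_n}) : Prop :=
  forall A : 'M[C]_n, psdmx A -> 0 <= rho A.

Definition faithful_functional n (rho : {scalar 'M[C]_n}) : Prop :=
  forall A : 'M[C]_n, psdmx A -> A != 0 -> 0 < rho A.

Lemma functionalE n (rho : {scalar 'M[C]_n}) (A : 'M[C]_n) :
  rho A = \sum_i \sum_j rho (delta_mx i j) * A i j.
Proof.
rewrite {1}[A]matrix_sum_delta linear_sum; apply: eq_bigr => i _.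
rewrite linear_sum; apply: eq_bigr => j _.
by rewrite mulrC; exact: linearZ.
Qed.

End Operators.

Section TensorPowers.
Variables (C : numClosedFieldType) (d : nat).

(* (C^d)^(x)l has a basis indexed by the l-tuples over 'I_d. *)
Definition tdim (l : nat) : nat := #|{: l.-tuple 'I_d}|.

Definition tensmxn l (x : 'I_l -> 'M[C]_d) : 'M[C]_(tdim l) :=
  \matrix_(i, j) \prod_(k < l) x k (tnth (enum_val i) k) (tnth (enum_val j) k).

Definition tindex l (s : 'S_l) (i : 'I_(tdim l)) : 'I_(tdim l) :=
  enum_rank [tuple tnth (enum_val i) ((s^-1)%g k) | k < l].

(* See [tperm_act_tens] for the action on elementary tensors. *)
Definition tperm_act l (s : 'S_l) (X : 'M[C]_(tdim l)) : 'M[C]_(tdim l) :=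
  \matrix_(i, j) X (tindex s i) (tindex s j).

Definition symmetric_tensor l (X : 'M[C]_(tdim l)) : Prop :=
  forall s : 'S_l, tperm_act s X = X.

Definition tsnoc l (i : 'I_(tdim l)) (a : 'I_d) : 'I_(tdim l.+1) :=
  enum_rank [tuple of rcons (enum_val i) a].

(* The map id^(x)l (x) rho; see [slice_tens]. *)
Definition slice (rho : {scalar 'M[C]_d}) l (X : 'M[C]_(tdim l.+1)) :
    'M[C]_(tdim l) :=
  \matrix_(i, j) rho (\matrix_(a, b) X (tsnoc i a) (tsnoc j b)).

Lemma tperm_act_is_linear l (s : 'S_l) : linear (@tperm_act l s).
Proof. by move=> a X Y; apply/matrixP => i j; rewrite !mxE. Qed.

Lemma tperm_act_tens l (s : 'S_l) (x : 'I_l -> 'M[C]_d) :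
  tperm_act s (tensmxn x) = tensmxn (fun k => x (s k)).
Proof.
apply/matrixP => i j; rewrite !mxE (reindex_inj (@perm_inj _ s)) /=.
apply: eq_bigr => k _.
by rewrite !enum_rankK !tnth_mktuple permK.
Qed.

Lemma tensmxn_mul l (x y : 'I_l -> 'M[C]_d) :
  tensmxn x *m tensmxn y = tensmxn (fun k => x k *m y k).
Proof.
apply/matrixP => i j; rewrite !mxE.
under [RHS]eq_bigr do rewrite mxE.
rewrite bigA_distr_bigA /=.
pose F (f : {ffun 'I_l -> 'I_d}) : 'I_(tdim l) := enum_rank [tuple f k | k < l].
pose F' (p : 'I_(tdim l)) := [ffun k => tnth (enum_val p) k].
rewrite (reindex F) /=; last first.
  exists F' => [f|p] _; first by apply/ffunP => k; rewrite ffunE enum_rankK tnth_mktuple.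
  apply: enum_val_inj; rewrite enum_rankK; apply: eq_from_tnth => k.
  by rewrite tnth_mktuple ffunE.
apply: eq_bigr => f _; rewrite !mxE -big_split /=.
by apply: eq_bigr => k _; rewrite enum_rankK tnth_mktuple.
Qed.

Lemma tensmxn1 l : tensmxn (fun _ : 'I_l => 1%:M) = 1%:M.
Proof.
apply/matrixP => i j; rewrite !mxE; case: eqVneq => [->|neq_ij].
  by rewrite big1 // => k _; rewrite mxE eqxx.
have [k nk] : exists k, tnth (enum_val i) k != tnth (enum_val j) k.
  apply/existsP; apply: contraR neq_ij => /existsPn eq_ij.
  apply/eqP/enum_val_inj/eq_from_tnth => k.
  by apply/eqP; move: (eq_ij k); rewrite negbK.
by rewrite (bigD1 k) //= mxE (negPf nk) mul0r.
Qed.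

Lemma tensmxn_adj l (x : 'I_l -> 'M[C]_d) :
  (tensmxn x)^t* = tensmxn (fun k => (x k)^t*).
Proof.
apply/matrixP => i j; rewrite !mxE rmorph_prod.
by apply: eq_bigr => k _; rewrite !mxE.
Qed.

Lemma slice_is_linear rho l : linear (@slice rho l).
Proof.
move=> a X Y; apply/matrixP => i j; rewrite !mxE -[X in X = _]/(_ : C).
rewrite -linearP; congr (rho _); apply/matrixP => p q; by rewrite !mxE.
Qed.

Lemma slice_tens rho l (x : 'I_l.+1 -> 'M[C]_d) :
  slice rho (tensmxn x) =
  rho (x ord_max) *: tensmxn (fun k => x (widen_ord (leqnSn l) k)).
Proof.
apply/matrixP => i j; rewrite !mxE mulrC -linearZ; congr (rho _).
apply/matrixP => a b; rewrite !mxE big_ord_recr /= !enum_rankK.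
have tn_max (t : l.-tuple 'I_d) c : tnth [tuple of rcons t c] ord_max = c.
  by rewrite (tnth_nth c) /= nth_rcons size_tuple ltnn eqxx.
have tn_wid (t : l.-tuple 'I_d) c k :
    tnth [tuple of rcons t c] (widen_ord (leqnSn l) k) = tnth t k.
  by rewrite !(tnth_nth c) /= nth_rcons size_tuple ltn_ord.
by rewrite !tn_max; congr (_ * _); apply: eq_bigr => k _; rewrite !tn_wid.
Qed.

End TensorPowers.
Arguments tdim d l : clear implicits.

Section MatrixContinuity.
Variables (C : numFieldType) (T : topologicalType).

Lemma continuous_mx m n (f : T -> 'M[C]_(m, n)) :
  (forall i j, continuous (fun t => f t i j : C)) -> continuous f.
Proof.
move=> cf x A [B nB BA].
have : \forall t \near x, forall p : 'I_m * 'I_n, B p.1 p.2 (f t p.1 p.2).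
  by apply: filter_forall => p; apply: cf; apply: nB.
by apply: filterS => t Bt; apply: BA => i j; apply: (Bt (i, j)).
Qed.

Lemma continuous_mxE m n (f : T -> 'M[C]_(m, n)) i j :
  continuous f -> continuous (fun t => f t i j : C).
Proof.
move=> cf x; apply: (@continuous_comp _ _ _ f (fun M : 'M[C]_(m, n) => M i j)).
  exact: cf.
exact: coord_continuous.
Qed.

Lemma continuous_prod_ord l (f : 'I_l -> T -> C) :
  (forall k, continuous (f k)) -> continuous (fun t => \prod_(k < l) f k t).
Proof.
move=> cf x; elim: l => [|l IHl] in f cf *.
  by under eq_fun do rewrite big_ord0; apply: cvg_cst.
under eq_fun do rewrite big_ord_recr.

by apply: cvgM; [apply: IHl => k; apply: cf|apply: cf].
Qed.

End MatrixContinuity.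

Section Representations.
Variables (R : realType) (G : topologicalGroupType).
Local Notation C := (Cplx R).

Record unirep (n : nat) := Unirep {
  urep :> G -> 'M[C]_n;
  urep1 : urep 1%g = 1%:M;
  urepM : forall g h, urep (g * h)%g = urep g *m urep h;
  urep_unitary : forall g, urep g \is unitarymx;
  urep_continuous : continuous urep
}.

Definition irreducible_rep n (pi : unirep n) : Prop :=
  (0 < n)%N /\
  forall W : {vspace 'cV[C]_n},
    (forall g (v : 'cV[C]_n), v \in W -> pi g *m v \in W) ->
    W = 0%VS \/ W = fullv.

(* An isometric intertwiner from C^n1 to C^n2. *)
Definition subrep n1 n2 (pi1 : unirep n1) (pi2 : unirep n2) : Prop :=
  exists V : 'M[C]_(n2, n1),
    V^t* *m V = 1%:M /\ forall g, pi2 g *m V = V *m pi1 g.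

Definition equiv_rep n1 n2 (pi1 : unirep n1) (pi2 : unirep n2) : Prop :=
  exists V : 'M[C]_(n2, n1),
    [/\ V^t* *m V = 1%:M, V *m V^t* = 1%:M
      & forall g, pi2 g *m V = V *m pi1 g].

(* Every irreducible unitary representation of a compact group is
   finite-dimensional, so [irrep] loses nothing. *)
Record irrep := Irrep {
  idim : nat;
  irep : unirep idim;
  irep_irr : irreducible_rep irep
}.

(* The dual of G as a set of unitary equivalence classes. *)
Definition dual_classes : set (set irrep) :=
  range (fun pi : irrep => [set sigma : irrep | equiv_rep (irep pi) (irep sigma)]).

Definition mcoef n (pi : unirep n) (xi eta : 'cV[C]_n) : G -> C^o :=
  fun t => inner (pi t *m xi) eta.

Definition coef_span (f : G -> C^o) : Prop :=
  exists (k : nat) (h : 'I_k -> G -> C^o) (c : 'I_k -> C),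
    (forall i, exists n (pi : unirep n) xi eta, h i = mcoef pi xi eta) /\
    f = \sum_(i < k) c i *: h i.

Definition coef_pred : {pred G -> C^o} := [pred f | `[< coef_span f >]].

Lemma coef_pred_submod : submod_closed coef_pred.
Proof.
split=> [|a u v /asboolP[k [h [c [hP ->]]]] /asboolP[k' [h' [c' [hP' ->]]]]].
  apply/asboolP; exists 0%N, (fun _ => 0), (fun _ => 0).
  by split=> [[]//|]; rewrite big_ord0.
apply/asboolP; exists (k + k')%N.
exists (fun i => match fintype.split i with inl j => h j | inr j => h' j end).
exists (fun i => match fintype.split i with inl j => a * c j | inr j => c' j end).
split=> [i|]; first by case: (fintype.split i).
rewrite big_split_ord /= scaler_sumr; congr (_ + _); apply: eq_bigr => i _.
  by rewrite (unsplitK (inl i)) scalerA.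
by rewrite (unsplitK (inr i)).
Qed.

HB.instance Definition _ :=
  GRing.isSubmodClosed.Build C (G -> C^o) coef_pred (GRing.submod_closed_semi coef_pred_submod).

(* C[G]; its product is [coefalg_mul]. *)
Record coefalg := Coefalg {
  coefalg_val :> G -> C^o;
  coefalgP : coefalg_val \in coef_pred
}.

HB.instance Definition _ := [isSub for coefalg_val].
HB.instance Definition _ := [Choice of coefalg by <:].
HB.instance Definition _ := [SubChoice_isSubLmodule of coefalg by <:].

Lemma mcoef_in n (pi : unirep n) xi eta : mcoef pi xi eta \in coef_pred.
Proof.
apply/asboolP; exists 1%N, (fun _ => mcoef pi xi eta), (fun _ => 1).
by split=> [_|]; [exists n, pi, xi, eta | rewrite big_ord1 scale1r].
Qed.

Definition mcoefC n (pi : unirep n) (xi eta : 'cV[C]_n) : coefalg :=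
  Coefalg (mcoef_in pi xi eta).

Section Tensor2.
Variables (n1 n2 : nat) (pi1 : unirep n1) (pi2 : unirep n2).
Let f (t : G) : 'M[C]_(n1 * n2) := tensmx (pi1 t) (pi2 t).

Let tens1 : tensmx 1%:M 1%:M = 1%:M :> 'M[C]_(n1 * n2).
Proof.
apply/matrixP => i j; rewrite !mxE -natrM mulnb; congr (_%:R); congr nat_of_bool.
by rewrite -xpair_eqE -!surjective_pairing (can_eq (@mxtens_unindexK _ _)).
Qed.

Let f1 : f 1%g = 1%:M.
Proof. by rewrite /f !urep1 tens1. Qed.

Let fM g h : f (g * h)%g = f g *m f h.
Proof. by rewrite /f !urepM tensmx_mul. Qed.

Let fU g : f g \is unitarymx.
Proof.
have fadj : (f g)^t* = tensmx ((pi1 g)^t*) ((pi2 g)^t*).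
  by apply/matrixP => i j; rewrite !mxE rmorphM.
apply/unitarymxP; rewrite fadj tensmx_mul.
by rewrite !(unitarymxP (urep_unitary _ _)) tens1.
Qed.

Let fC : continuous f.
Proof.
apply: continuous_mx => i j x; under eq_fun do rewrite mxE.
by apply: cvgM; apply: continuous_mxE; apply: urep_continuous.
Qed.

Definition tensrep2 := Unirep f1 fM fU fC.
End Tensor2.

Lemma coef_pred_mul (f g : G -> C^o) :
  f \in coef_pred -> g \in coef_pred -> (fun t => f t * g t) \in coef_pred.
Proof.
move=> /asboolP[k [h [c [hP ->]]]] /asboolP[k' [h' [c' [hP' ->]]]].
have -> : (fun t => (\sum_(i < k) c i *: h i) t *
                    (\sum_(j < k') c' j *: h' j) t) =
  \sum_(i < k) \sum_(j < k') (c i * c' j) *: (fun t => h i t * h' j t).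
  apply/funext => t; rewrite !fct_sumE mulr_suml; apply: eq_bigr => i _.
  rewrite fct_sumE mulr_sumr; apply: eq_bigr => j _.
  by rewrite /= /GRing.scale/= mulrACA.
apply: rpred_sum => i _; apply: rpred_sum => j _; apply: rpredZ.
have [n [pi [xi [eta ->]]]] := hP i; have [n' [pi' [xi' [eta' ->]]]] := hP' j.
have -> : (fun t => mcoef pi xi eta t * mcoef pi' xi' eta' t) =
    mcoef (tensrep2 pi pi') (tensmx xi xi') (tensmx eta eta').
  apply/funext => t; rewrite /mcoef /inner /=.
  have -> : (tensmx eta eta')^t* = tensmx (eta^t*) (eta'^t*).
    by apply/matrixP => p q; rewrite !mxE rmorphM.
  have -> : tensmx (pi t) (pi' t) *m (tensmx xi xi' : 'cV_(n * n')) =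
      tensmx (pi t *m xi) (pi' t *m xi') 
    by exact: (tensmx_mul (pi t) (pi' t) xi xi').
  pose z : 'I_(1 * 1) := mxtens_index (0, 0).
  transitivity ((tensmx (eta^t*) (eta'^t*) *m
                 tensmx (pi t *m xi) (pi' t *m xi')) z z).
    by rewrite tensmx_mul tensmxE.
  by congr (_ _ _); apply: ord_inj.
exact: mcoef_in.
Qed.

Definition coefalg_mul (f g : coefalg) : coefalg :=
  Coefalg (coef_pred_mul (coefalgP f) (coefalgP g)).

(* U(G), the algebraic dual of C[G]. *)
Definition calU : Type := {scalar coefalg}.

Section DualZmodule.
Implicit Types x y : calU.

HB.instance Definition _ := gen_eqMixin calU.
HB.instance Definition _ := gen_choiceMixin calU.

Lemma calUP x y : (forall f, x f = y f) -> x = y.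
Proof.
move=> xy; case: x y xy => x [[xA] [xZ]] [y [[yA] [yZ]]] /= /funext xy.
subst y; congr (GRing.Linear.Pack (GRing.Linear.Class _ _)); congr (_ _);
exact: Prop_irrelevance.
Qed.

Let addU x y : calU := x \+ y.
Let oppU x : calU := \- x.
Let zeroU : calU := \0.

Let addUA : associative addU.
Proof. by move=> x y z; apply: calUP => f /=; rewrite addrA. Qed.
Let addUC : commutative addU.
Proof. by move=> x y; apply: calUP => f /=; rewrite addrC. Qed.
Let add0U : left_id zeroU addU.
Proof. by move=> x; apply: calUP => f /=; rewrite add0r. Qed.
Let addNU : left_inverse zeroU oppU addU.
Proof. by move=> x; apply: calUP => f /=; rewrite addNr. Qed.

HB.instance Definition _ := GRing.isZmodule.Build calU addUA addUC add0U addNU.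

Lemma calU_sumZ x (I : Type) (r : seq I) (P : pred I) (c : I -> C)
    (F : I -> coefalg) :
  x (\sum_(i <- r | P i) c i *: F i) = \sum_(i <- r | P i) c i * x (F i).
Proof. by rewrite linear_sum; apply: eq_bigr => i _; exact: linearZ. Qed.

Lemma calU_sum x (I : Type) (r : seq I) (P : pred I) (F : I -> coefalg) :
  x (\sum_(i <- r | P i) F i) = \sum_(i <- r | P i) x (F i).
Proof. exact: linear_sum. Qed.

Lemma calU_addE x y f : (x + y) f = x f + y f. Proof. by []. Qed.
Lemma calU_oppE x f : (- x) f = - x f. Proof. by []. Qed.
End DualZmodule.


Lemma coefalgE (I : Type) (r : seq I) (P : pred I) (c : I -> C)
    (F : I -> coefalg) t :
  (\sum_(i <- r | P i) c i *: F i) t = \sum_(i <- r | P i) c i * F i t.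
Proof.
rewrite -[LHS]/(val (\sum_(i <- r | P i) c i *: F i) t) raddf_sum fct_sumE.
by apply: eq_bigr.
Qed.

Lemma coefalg_sumE (I : Type) (r : seq I) (P : pred I) (F : I -> coefalg) t :
  (\sum_(i <- r | P i) F i) t = \sum_(i <- r | P i) F i t.
Proof.
by rewrite -[LHS]/(val (\sum_(i <- r | P i) F i) t) raddf_sum fct_sumE.
Qed.

Lemma mcoef_delta n (pi : unirep n) i j t :
  mcoef pi (delta_mx j 0) (delta_mx i 0) t = pi t i j.
Proof.
rewrite /mcoef /inner.
have -> : (delta_mx i 0 : 'cV[C]_n)^t* = delta_mx 0 i.
  by apply/matrixP => p q; rewrite !mxE rmorph_nat andbC.
by rewrite -colE -rowE !mxE.
Qed.

(* The extension of pi to U(G); [<pi(x) e_j, e_i>] is the (i, j) entry of pi(x),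
   and [rep_extE] is the defining identity for arbitrary vectors. *)
Definition rep_ext n (pi : unirep n) (x : calU) : 'M[C]_n :=
  \matrix_(i, j) x (mcoefC pi (delta_mx j 0) (delta_mx i 0)).

Lemma rep_extE n (pi : unirep n) (x : calU) (xi eta : 'cV[C]_n) :
  inner (rep_ext pi x *m xi) eta = x (mcoefC pi xi eta).
Proof.
have -> : mcoefC pi xi eta = \sum_i \sum_j
    ((eta i 0)^* * xi j 0) *: mcoefC pi (delta_mx j 0) (delta_mx i 0).
  apply: val_inj; apply/funext => t; rewrite /= coefalg_sumE.
  rewrite /mcoef /inner mxE; apply: eq_bigr => i _.
  rewrite coefalgE !mxE mulr_sumr; apply: eq_bigr => j _.
  by rewrite /= mcoef_delta -mulrA [xi j 0 * _]mulrC.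
rewrite calU_sum /inner mxE; apply: eq_bigr => i _.
rewrite calU_sumZ !mxE mulr_sumr; apply: eq_bigr => j _.
by rewrite !mxE -mulrA [xi j 0 * _]mulrC.
Qed.

Definition posU m (X : 'M[calU]_m) : Prop :=
  forall n (pi : unirep n), psdblock (map_mx (rep_ext pi) X).

Section TensorPowerRep.
Variables (d : nat) (Pi : unirep d) (l : nat).
Let f (t : G) : 'M[C]_(tdim d l) := tensmxn (fun _ => Pi t).

Let f1 : f 1%g = 1%:M.
Proof. by rewrite /f urep1 tensmxn1. Qed.

Let fM g h : f (g * h)%g = f g *m f h.
Proof. by rewrite /f tensmxn_mul urepM. Qed.

Let fU g : f g \is unitarymx.
Proof.
apply/unitarymxP; rewrite tensmxn_adj tensmxn_mul.
by rewrite (unitarymxP (urep_unitary _ _)) tensmxn1.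
Qed.

Let fC : continuous f.
Proof.
apply: continuous_mx => i j x; under eq_fun do rewrite mxE.
apply: continuous_prod_ord => k; apply: continuous_mxE; exact: urep_continuous.
Qed.

(* The representation Pi^(x)l; for l = 0 it is the trivial one. *)
Definition tensrep : unirep (tdim d l) := Unirep f1 fM fU fC.
End TensorPowerRep.

Section Main.
Variables (d : nat) (Pi : unirep d) (rho : {scalar 'M[C]_d}).

Lemma frho_in : (fun t => rho (Pi t)) \in coef_pred.
Proof.
have -> : (fun t => rho (Pi t)) = \sum_i \sum_j
    rho (delta_mx i j) *: mcoef Pi (delta_mx j 0) (delta_mx i 0).
  apply/funext => t; rewrite functionalE fct_sumE.
  apply: eq_bigr => i _; rewrite fct_sumE; apply: eq_bigr => j _.
  by rewrite -mcoef_delta.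
by apply: rpred_sum => i _; apply: rpred_sum => j _; apply/rpredZ/mcoef_in.
Qed.

(* The element of C[G] representing the functional rho o Pi on U(G). *)
Definition frho : coefalg := Coefalg frho_in.

Lemma frhoE (x : calU) : rho (rep_ext Pi x) = x frho.
Proof.
have -> : frho = \sum_i \sum_j
    rho (delta_mx i j) *: mcoefC Pi (delta_mx j 0) (delta_mx i 0).
  apply: val_inj; apply/funext => t; rewrite /= coefalg_sumE.
  rewrite functionalE; apply: eq_bigr => i _.
  by rewrite coefalgE; apply: eq_bigr => j _; rewrite /= mcoef_delta.
rewrite functionalE calU_sum; apply: eq_bigr => i _.
by rewrite calU_sumZ; apply: eq_bigr => j _; rewrite mxE.
Qed.

Definition Prho_fun (x : calU) (f : coefalg) : C := x (coefalg_mul f frho).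

Lemma Prho_fun_linear (x : calU) : scalar (Prho_fun x).
Proof.
move=> a f g; rewrite /Prho_fun.
have -> : coefalg_mul (a *: f + g) frho =
    a *: coefalg_mul f frho + coefalg_mul g frho.
  apply: val_inj; apply/funext => t.
  transitivity ((a * f t + g t) * frho t); first by [].
  transitivity (a * (f t * frho t) + g t * frho t); last by [].
  by rewrite mulrDl mulrA.
exact: (linearP x).
Qed.

HB.instance Definition _ (x : calU) :=
  GRing.isLinear.Build C coefalg C *%R (Prho_fun x) (Prho_fun_linear x).

Definition Prho (x : calU) : calU := Prho_fun x.

Lemma PrhoE x f : Prho x f = x (coefalg_mul f frho). Proof. by []. Qed.

Definition Bset m : set 'M[calU]_m :=
  [set X | posU X /\ posU (X - map_mx Prho X)].

Definition Kset m : set (forall l, 'M['M[C]_(tdim d l)]_m) :=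
  fun x => forall l, [/\ forall i j, symmetric_tensor (x l i j),
     psdblock (x l) & psdblock (x l - map_mx (slice rho (l:=l)) (x l.+1))].

Definition Pi_infty m (X : 'M[calU]_m) : forall l, 'M['M[C]_(tdim d l)]_m :=
  fun l => map_mx (rep_ext (tensrep Pi l)) X.

(* [subrep] only depends on the class of alpha, so alpha may range over all
   irreducible representations instead of chosen representatives. *)
Definition generating : Prop :=
  forall alpha : irrep, exists l : nat, subrep (irep alpha) (tensrep Pi l).

End Main.

End Representations.

Arguments unirep R G n : clear implicits.
Arguments dual_classes R G : clear implicits.
Arguments calU R G : clear implicits.
Arguments Bset {R G d} Pi rho m.
Arguments Kset {R d} rho m.
Arguments Pi_infty {R G d} Pi {m} X l.

(* Main.v *)
Require Import Defs.
From mathcomp Require Import all_boot all_order all_algebra perm.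
From mathcomp Require Import all_classical all_reals all_analysis.

(** The inclusion rests on one identity of matrix coefficients: multiplying an
    entry of [Pi^(x)l] by [f_rho = rho o Pi] gives a linear combination of
    entries of [Pi^(x)(l+1)], namely the one obtained by slicing the last tensor
    leg with [rho].  Dually, [(id (x) rho) o Pi^(x)(l+1) = Pi^(x)l o P_rho]
    ([slice_rep_ext]), so [Pi_infty] turns the inequality [P_rho x <= x] into
    the inequalities defining [Kset].  The components are symmetric because
    every [Pi t (x) ... (x) Pi t] is ([rep_ext_tensrep_symmetric]), and they are
    positive because positivity in [U(G)] is tested on all representations,
    the tensor powers included.

    Injectivity is a separation statement: an element of [U(G)] is determined by
    its images under the irreducible representations ([rep_ext_irrep_inj]).
    Every finite-dimensional unitary representation is an orthogonal sum of
    irreducible ones, so its matrix coefficients are sums of coefficients of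
    irreducible representations, and coefficients span [C[G]].  Complete
    reducibility is obtained by induction on the dimension: an invariant
    subspace and its orthogonal complement carry compressions of the
    representation of smaller dimension ([reducible_splits]).  If [Pi] is
    generating, the coefficients of an irreducible representation are
    coefficients of some tensor power of [Pi] ([rep_ext_subrep]), on which the
    two elements agree. *)

Set Implicit Arguments.
Unset Strict Implicit.
Unset Printing Implicit Defensive.

Import GRing.Theory Num.Theory.
Import numFieldNormedType.Exports.

Local Open Scope classical_set_scope.
Local Open Scope sesquilinear_scope.
Local Open Scope ring_scope.

Section OrthogonalDecomposition.
Variable C : numClosedFieldType.

Local Notation orthocomp := (orthomx Num.conj (mx_of_hermitian (hermitian1mx _))).

Lemma adjmxM m n p (A : 'M[C]_(m, n)) (B : 'M[C]_(n, p)) :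
  (A *m B)^t* = B^t* *m A^t*.
Proof. by rewrite trmx_mul map_mxM. Qed.

Lemma eq_mulmx_cV m n (A B : 'M[C]_(m, n)) :
  (forall v : 'cV_n, A *m v = B *m v) -> A = B.
Proof.
move=> AB; apply/matrixP => i j.
by move/(congr1 (fun v : 'cV_m => v i 0)): (AB (delta_mx j 0)); rewrite -!colE !mxE.
Qed.

(** Passing to rows lets Gram-Schmidt orthonormalize a basis of [W].  The rows are
    adjoints rather than transposes of the basis vectors, so that the orthonormal
    rows obtained form the adjoint of an isometry with range [W]. *)
Lemma mem_vspace_adj_rows n (W : {vspace 'cV[C]_n}) (v : 'cV[C]_n) :
  (v \in W) = (v^t* <= \matrix_(i < \dim W) ((vbasis W)`_i)^t*)%MS.
Proof.
have adj_sum (D : 'rV[C]_(\dim W)) :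
    (\sum_i (D 0 i)^* *: (vbasis W)`_i)^t* =
    D *m \matrix_(i < \dim W) ((vbasis W)`_i)^t*.
  rewrite mulmx_sum_row; apply/matrixP => a b; rewrite !mxE !summxE rmorph_sum.
  by apply: eq_bigr => i _; rewrite !mxE rmorphM /= conjCK ord1.
apply/idP/submxP => [vW|[D vD]].
  exists (\row_i (coord (vbasis W) i v)^*); rewrite -adj_sum {1}(coord_vbasis vW).
  by congr (_^t*); apply: eq_bigr => i _; rewrite mxE conjCK.
rewrite -[v]trmxCK vD -adj_sum trmxCK.
by apply: rpred_sum => i _; rewrite rpredZ// vbasis_mem// mem_nth// size_tuple.
Qed.

(** The isometries [V1] and [V2] are orthonormal bases of [W] and of its
    orthogonal complement, so that [V1 *m V1^t*] is the projection onto [W]. *)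
Lemma orthogonal_decomposition n (W : {vspace 'cV[C]_n}) :
  exists k1 k2 (V1 : 'M[C]_(n, k1)) (V2 : 'M[C]_(n, k2)),
    [/\ (k1 + k2 = n)%N, V1^t* *m V1 = 1%:M, V2^t* *m V2 = 1%:M,
        V1 *m V1^t* + V2 *m V2^t* = 1%:M
      & forall v, (v \in W) = (V1 *m V1^t* *m v == v)].
Proof.
pose A := \matrix_(i < \dim W) ((vbasis W)`_i)^t*.
pose U1 := schmidt (row_base A); pose U2 := schmidt (row_base (orthocomp A)).
have U1u : U1 \is unitarymx by rewrite schmidt_unitarymx// rank_leq_col.
have U2u : U2 \is unitarymx by rewrite schmidt_unitarymx// rank_leq_col.
have dimE : (\rank A + \rank (orthocomp A) = n)%N.
  by rewrite rank_ortho subnKC// rank_leq_col.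
have eqU1 : (U1 :=: A)%MS.
  apply: eqmx_trans (eq_row_base A).
  by apply: eqmx_schmidt_free; rewrite row_base_free.
exists (\rank A), (\rank (orthocomp A)), (U1^t*), (U2^t*).
split=> //; rewrite ?trmxCK; try exact: unitarymxP.
  have := mulmxKtV 1%:M (schmidt_complete_unitarymx A) dimE.
  by rewrite mul1mx /schmidt_complete tr_col_mx map_row_mx mul_row_col.
move=> v; rewrite mem_vspace_adj_rows -/A -eqU1; apply/submxP/eqP => [[D vD]|<-].
  apply: (can_inj (@trmxCK _ _ _)).
  by rewrite !adjmxM trmxCK vD -!mulmxA (mulmxA U1) (unitarymxP U1u) mul1mx.
by exists (v^t* *m U1^t*); rewrite !adjmxM trmxCK mulmxA.
Qed.

End OrthogonalDecomposition.

Section CompleteReducibility.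
Variables (R : realType) (G : topologicalGroupType).
Local Notation C := (Cplx R).

Lemma continuous_mulmx (T : topologicalType) m n p
    (f : T -> 'M[C]_(m, n)) (g : T -> 'M[C]_(n, p)) :
  continuous f -> continuous g -> continuous (fun t => f t *m g t).
Proof.
move=> cf cg; apply: continuous_mx => i j x; under eq_fun do rewrite mxE.
apply: cvg_big => [|k _]; first exact: add_continuous.
by apply: cvgM; exact: continuous_mxE.
Qed.

Lemma urepV n (pi : unirep R G n) g : pi (g^-1)%g = (pi g)^t*.
Proof.
rewrite -[LHS]mul1mx.
have <- : (pi g)^t* *m pi g = 1%:M.
  exact/mulmx1C/unitarymxP/urep_unitary.
by rewrite -mulmxA -urepM mulgV urep1 mulmx1.
Qed.

(** The hypothesis [stableV] says that the range of the isometry [V] is invariant; hence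
    [V *m V^t*] may be inserted between two values of [pi], and the compression
    is again multiplicative. *)
Section Compression.
Variables (n k : nat) (pi : unirep R G n) (V : 'M[C]_(n, k)).
Hypothesis isoV : V^t* *m V = 1%:M.
Hypothesis stableV : forall g, V *m V^t* *m (pi g *m V) = pi g *m V.

Let f g : 'M[C]_k := V^t* *m pi g *m V.

Let f1 : f 1%g = 1%:M.
Proof. by rewrite /f urep1 mulmx1. Qed.

Let fM g h : f (g * h)%g = f g *m f h.
Proof. by rewrite /f urepM -!mulmxA -[in LHS]stableV -!mulmxA. Qed.

Let fU g : f g \is unitarymx.
Proof.
apply/unitarymxP.
have -> : (f g)^t* = f (g^-1)%g by rewrite /f !adjmxM trmxCK urepV mulmxA.
by rewrite -fM mulgV.
Qed.

Let fC : continuous f.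
Proof.
apply: continuous_mulmx; last exact: cst_continuous.
by apply: continuous_mulmx (@urep_continuous _ _ _ pi); exact: cst_continuous.
Qed.

Definition compression : unirep R G k := Unirep f1 fM fU fC.

Lemma compression_intertwines g : pi g *m V = V *m compression g.
Proof. by rewrite /= /f -[LHS]stableV !mulmxA. Qed.
End Compression.

(** Intertwiners move between the coefficients of two representations, which is
    what both sub-representations and orthogonal sums are used for. *)
Lemma mcoef_intertwine n1 n2 (pi1 : unirep R G n1) (pi2 : unirep R G n2)
    (V : 'M[C]_(n2, n1)) xi eta :
  (forall g, pi2 g *m V = V *m pi1 g) ->
  mcoef pi2 (V *m xi) eta = mcoef pi1 xi (V^t* *m eta).
Proof.
move=> intV; apply/funext => g.
by rewrite /mcoef /inner adjmxM trmxCK (mulmxA (pi2 g)) intV !mulmxA.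
Qed.

(** Unitarity is what makes the orthogonal complement invariant too: the adjoint
    of [pi g] is [pi g^-1], which preserves the given subspace. *)
Lemma reducible_splits n (pi : unirep R G n) :
  (0 < n)%N -> ~ irreducible_rep pi ->
  exists k1 k2 (pi1 : unirep R G k1) (pi2 : unirep R G k2)
      (V1 : 'M[C]_(n, k1)) (V2 : 'M[C]_(n, k2)),
    [/\ (k1 < n)%N, (k2 < n)%N, V1 *m V1^t* + V2 *m V2^t* = 1%:M,
        forall g, pi g *m V1 = V1 *m pi1 g
      & forall g, pi g *m V2 = V2 *m pi2 g].
Proof.
move=> n_gt0 red.
have [W [Wpi W0 W1]] : exists W : {vspace 'cV[C]_n},
    [/\ forall g (v : 'cV[C]_n), v \in W -> pi g *m v \in W,
        W <> 0%VS & W <> fullv].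
  apply: contrapT => noW; apply: red; split=> // W Wpi.
  by apply: contrapT => /not_orP[W0 W1]; apply: noW; exists W.
have [k1 [k2 [V1 [V2 [kE iso1 iso2 cpl WP]]]]] := orthogonal_decomposition W.
have k1_gt0 : (0 < k1)%N.
  rewrite lt0n; apply/eqP => k0; apply: W0; apply/vspaceP => v.
  rewrite memv0 WP; subst k1.
  by rewrite [V1]thinmx0 !mul0mx eq_sym.
have k2_gt0 : (0 < k2)%N.
  rewrite lt0n; apply/eqP => k0; apply: W1; apply/vspaceP => v.
  rewrite memvf WP; subst k2.
  by move: cpl; rewrite [V2]thinmx0 mul0mx addr0 => ->; rewrite mul1mx eqxx.
have st1 g : V1 *m V1^t* *m (pi g *m V1) = pi g *m V1.
  apply: eq_mulmx_cV => v; have : V1 *m v \in W.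
    by rewrite WP -mulmxA (mulmxA _ V1) iso1 mul1mx.
  by move=> /(Wpi g); rewrite WP !mulmxA => /eqP.
have V21 : V2^t* *m V1 = 0.
  have := congr1 (mulmx (V2^t*)) cpl.
  rewrite mulmx1 mulmxDr (mulmxA _ V2) iso2 mul1mx -[RHS]add0r => /addIr.
  by move/(congr1 (mulmx^~ V1)); rewrite -!mulmxA iso1 mulmx1 mul0mx.
have st2 g : V2 *m V2^t* *m (pi g *m V2) = pi g *m V2.
  have V1pi2 : V1^t* *m (pi g *m V2) = 0.
    apply: (can_inj (@trmxCK _ _ _)).
    by rewrite !adjmxM trmxCK -urepV -mulmxA -st1 !mulmxA V21 !mul0mx ?(map_mx0, trmx0).
  rewrite -[RHS]mul1mx -cpl mulmxDl -[V1 *m _ *m _]mulmxA V1pi2 mulmx0.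
  by rewrite add0r.
exists k1, k2, (compression iso1 st1), (compression iso2 st2), V1, V2.
split=> //; try exact: compression_intertwines.
- by rewrite -kE -[ltnLHS]addn0 ltn_add2l.
- by rewrite -kE -[ltnLHS]add0n ltn_add2r.
Qed.

Lemma rep_ext_eqP n (pi : unirep R G n) (x y : calU R G) :
  rep_ext pi x = rep_ext pi y <->
  forall xi eta, x (mcoefC pi xi eta) = y (mcoefC pi xi eta).
Proof.
split=> [xy xi eta|xy]; first by rewrite -!rep_extE xy.
by apply/matrixP => i j; rewrite !mxE.
Qed.

Lemma rep_ext_subrep n1 n2 (pi1 : unirep R G n1) (pi2 : unirep R G n2)
    (x y : calU R G) :
  subrep pi1 pi2 -> rep_ext pi2 x = rep_ext pi2 y ->
  rep_ext pi1 x = rep_ext pi1 y.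
Proof.
move=> [V [isoV intV]] /rep_ext_eqP xy; apply/rep_ext_eqP => xi eta.
have -> : mcoefC pi1 xi eta = mcoefC pi2 (V *m xi) (V *m eta).
  by apply: val_inj; rewrite /= (mcoef_intertwine _ _ intV) mulmxA isoV mul1mx.
exact: xy.
Qed.

Lemma mcoefC_split n k1 k2 (pi : unirep R G n) (pi1 : unirep R G k1)
    (pi2 : unirep R G k2) (V1 : 'M[C]_(n, k1)) (V2 : 'M[C]_(n, k2)) xi eta :
  V1 *m V1^t* + V2 *m V2^t* = 1%:M ->
  (forall g, pi g *m V1 = V1 *m pi1 g) ->
  (forall g, pi g *m V2 = V2 *m pi2 g) ->
  mcoefC pi xi eta = mcoefC pi1 (V1^t* *m xi) (V1^t* *m eta)
                   + mcoefC pi2 (V2^t* *m xi) (V2^t* *m eta).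
Proof.
move=> cpl int1 int2; apply: val_inj.
transitivity (mcoef pi1 (V1^t* *m xi) (V1^t* *m eta)
            + mcoef pi2 (V2^t* *m xi) (V2^t* *m eta)); last by [].
rewrite -(mcoef_intertwine _ _ int1) -(mcoef_intertwine _ _ int2) /=.
apply/funext => g; rewrite -[xi in LHS]mul1mx -cpl mulmxDl.
by rewrite /mcoef /inner addrfctE !mulmxDr mxE !mulmxA.
Qed.

(** Splitting off invariant subspaces writes each matrix coefficient as a sum of
    coefficients of representations of smaller dimension, down to irreducible
    ones; the coefficients span [C[G]]. *)
Lemma rep_ext_irrep_inj (x y : calU R G) :
  (forall alpha : irrep R G, rep_ext (irep alpha) x = rep_ext (irep alpha) y) ->
  x = y.
Proof.
move=> xy_irr.
have xy_rep n (pi : unirep R G n) : rep_ext pi x = rep_ext pi y.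
  elim/ltn_ind: n pi => n IH pi.
  have [n0|n_gt0] := posnP n.
    by subst n; rewrite [LHS]thinmx0 [RHS]thinmx0.
  have [irr|] := pselect (irreducible_rep pi); first exact: xy_irr (Irrep irr).
  move=> /(reducible_splits n_gt0).
  move=> [k1 [k2 [pi1 [pi2 [V1 [V2 [lt1 lt2 cpl int1 int2]]]]]]].
  have /rep_ext_eqP xy1 := IH _ lt1 pi1; have /rep_ext_eqP xy2 := IH _ lt2 pi2.
  apply/rep_ext_eqP => xi eta.
  by rewrite (mcoefC_split _ _ cpl int1 int2) !linearD /= xy1 xy2.
apply: calUP => f; have /asboolP[k [h [c [hP fE]]]] := coefalgP f.
have hA i : h i \in coef_pred (G := G).
  by have [n [pi [xi [eta ->]]]] := hP i; exact: mcoef_in.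
have -> : f = \sum_(i < k) c i *: Coefalg (hA i).
  by apply: val_inj; apply/funext => t; rewrite /= coefalgE fE fct_sumE.
rewrite !calU_sumZ; apply: eq_bigr => i _; congr (_ * _).
have [n [pi [xi [eta hE]]]] := hP i.
have -> : Coefalg (hA i) = mcoefC pi xi eta by exact: val_inj.
by have /rep_ext_eqP -> := xy_rep n pi.
Qed.

End CompleteReducibility.

Section TensorPowerImage.
Variables (R : realType) (G : topologicalGroupType).
Local Notation C := (Cplx R).
Variables (d : nat) (Pi : unirep R G d) (rho : {scalar 'M[C]_d}).

Lemma rep_ext_tensrep_symmetric l (x : calU R G) :
  symmetric_tensor (rep_ext (tensrep Pi l) x).
Proof.
move=> s; apply/matrixP => i j; rewrite !mxE; congr (x _).
apply: val_inj; apply/funext => t; rewrite /= !mcoef_delta /=.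
have /matrixP/(_ i j) := tperm_act_tens s (fun _ => Pi t).
by rewrite mxE.
Qed.

(** Before pairing with [x] this is the pointwise identity
    [(id (x) rho) (Pi t)^(x)(l+1) = rho (Pi t) (Pi t)^(x)l]. *)
Lemma slice_rep_ext l (x : calU R G) :
  slice rho (rep_ext (tensrep Pi l.+1) x) =
  rep_ext (tensrep Pi l) (Prho Pi rho x).
Proof.
apply/matrixP => i j; rewrite !mxE PrhoE functionalE.
have -> : coefalg_mul (mcoefC (tensrep Pi l) (delta_mx j 0) (delta_mx i 0))
      (frho Pi rho) = \sum_a \sum_b rho (delta_mx a b) *:
    mcoefC (tensrep Pi l.+1) (delta_mx (tsnoc j b) 0) (delta_mx (tsnoc i a) 0).
  apply: val_inj; apply/funext => t; rewrite /= coefalg_sumE mcoef_delta /=.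
  have /matrixP/(_ i j) := slice_tens rho (fun _ : 'I_l.+1 => Pi t).
  rewrite mxE mxE mulrC => <-; rewrite functionalE; apply: eq_bigr => a _.
  by rewrite coefalgE; apply: eq_bigr => b _; rewrite /= mcoef_delta mxE.
rewrite calU_sum; apply: eq_bigr => a _; rewrite calU_sumZ.
by apply: eq_bigr => b _; rewrite !mxE.
Qed.

Lemma Pi_infty_Bset m (X : 'M[calU R G]_m) :
  Bset Pi rho m X -> Kset rho m (Pi_infty Pi X).
Proof.
move=> [X_pos X_super] l; split=> [i j||].
- by rewrite mxE; apply: rep_ext_tensrep_symmetric.
- exact: X_pos.
have -> : Pi_infty Pi X l - map_mx (slice rho (l := l)) (Pi_infty Pi X l.+1) =
    map_mx (rep_ext (tensrep Pi l)) (X - map_mx (Prho Pi rho) X).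
  apply/matrixP => i j; rewrite !mxE slice_rep_ext.
  by apply/matrixP => a b; rewrite !mxE.
exact: X_super.
Qed.

Lemma Pi_infty_inj m : generating Pi -> injective (@Pi_infty R G d Pi m).
Proof.
move=> genPi X Y XY; apply/matrixP => i j; apply: rep_ext_irrep_inj => alpha.
have [l sub_l] := genPi alpha; apply: (rep_ext_subrep sub_l).
by have /(congr1 (fun Z => Z l))/matrixP/(_ i j) := XY; rewrite !mxE.
Qed.

End TensorPowerImage.

Theorem proposition5p1 (R : realType) (G : topologicalGroupType)
    (cptG : compact [set: G]) (hausG : hausdorff_space G)
    (ctbG : countable (dual_classes R G))
    (d : nat) (Pi : unirep R G d)
    (rho : {scalar 'M[Cplx R]_d})
    (rho_pos : positive_functional rho) (rho_faithful : faithful_functional rho)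
    (m : nat) (m_ge1 : (1 <= m)%N) :
  @Pi_infty R G d Pi m @` Bset Pi rho m `<=` Kset rho m /\
  (generating Pi -> injective (@Pi_infty R G d Pi m)).
Proof.
split=> [_ [X XB <-]|genPi]; first exact: Pi_infty_Bset XB.
exact: Pi_infty_inj.
Qed.
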